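(* Let $A=k_{\mathfrak M}\langle x_1,\ldots,x_n\rangle$ be the free algebra of a variety $\mathfrak M$ of $m$-ary algebras over a field $k$, freely generated by $x_1,\ldots,x_n$. A derivation $D$ of $A$ is locally nilpotent if and only if $D$ is a left nilpotent element of $\mathscr{L}(A)$.
   Context: Let $m\ge 2$. An $m$-ary algebra over $k$ is a $k$-vector space with one $m$-ary multilinear operation $\langle\cdot,\ldots,\cdot\rangle$; a derivation is a $k$-linear map satisfying the Leibniz rule for this operation. If $m=2$ and $\mathfrak M$ is a unitary variety (a variety of algebras with identity element), $A$ is assumed to contain an identity element $1$. Convention: varieties are nontrivial and such that free algebras are graded by degrees in the free generators and every map from the free generators to the free algebra extends uniquely to a derivation (automatic if $k$ is infinite). For a column $F=(f_1,\ldots,f_n)'$ of elements of $A$, $D_F=f_1\partial_1+\cdots+f_n\partial_n$ denotes the unique derivation of $A$ with $D_F(x_i)=f_i$ for all $i$; in particular $a\partial_i$ is the derivation with $x_i\mapsto a$ and $x_j\mapsto 0$ for $j\ne i$. Every derivation of $A$ has a unique expression of this form. $\mathscr{L}(A)$ denotes the space $\mathrm{Der}_kA$ of all $k$-linear derivations of $A$ with the bilinear product determined by $(a\partial_i)\cdot(b\partial_j)=((a\partial_i)(b))\partial_j$ for $a,b\in A$. A derivation $D$ is locally nilpotent if for every $a\in A$ there is $p\ge 1$ with $D^{p}(a)=0$ (composition of maps). An element $a$ of a binary nonassociative algebra $G$ is left nilpotent if $a^r=0$ for some $r\ge 2$, where $a^1=a$ and $a^{r+1}=a(a^r)$. *)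

(* Defs.v *)
From HB Require Import structures.
From mathcomp Require Import all_boot all_order all_algebra.
From mathcomp Require Import boolp classical_sets functions.

Set Implicit Arguments.
Unset Strict Implicit.
Unset Printing Implicit Defensive.

Import GRing.Theory.
Local Open Scope ring_scope.

Definition upd (m : nat) (T : Type) (v : {ffun 'I_m -> T}) (i : 'I_m) (a : T) :
  {ffun 'I_m -> T} := [ffun j => if j == i then a else v j].

Definition multilinear (k : fieldType) (m : nat) (V : lmodType k)
    (op : {ffun 'I_m -> V} -> V) : Prop :=
  forall (i : 'I_m) (v : {ffun 'I_m -> V}), linear (fun a => op (upd v i a)).

(* The flag [u] says whether the signature contains an identity element; it is
   only meant to be set when m = 2, in which case [maone_id] says that
   <1, a> = a = <a, 1>. *)
Record malg (k : fieldType) (m : nat) (u : bool) := MAlg {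
  malg_sort :> lmodType k;
  maop : {ffun 'I_m -> malg_sort} -> malg_sort;
  maop_multilinear : multilinear maop;
  maone : u -> malg_sort;
  maone_id : forall (h : u) (i : 'I_m) (a : malg_sort),
    maop (upd [ffun=> maone h] i a) = a
}.

Definition alg_hom (k : fieldType) (m : nat) (u : bool) (A B : malg k m u)
    (f : A -> B) : Prop :=
  [/\ linear f,
      forall v : {ffun 'I_m -> A}, f (maop v) = maop [ffun i => f (v i)]
    & forall h : u, f (maone A h) = maone B h].

(* Nonassociative polynomials in the variables X_0, X_1, ... *)
Inductive term (k : fieldType) (m : nat) (u : bool) : Type :=
| TVar of nat
| TOne of u
| TZero
| TAdd of term k m u & term k m u
| TScale of k & term k m u
| TOp of ('I_m -> term k m u).

Fixpoint teval (k : fieldType) (m : nat) (u : bool) (A : malg k m u)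
    (e : nat -> A) (t : term k m u) : A :=
  match t with
  | TVar i => e i
  | TOne h => maone A h
  | TZero => 0
  | TAdd s t => teval e s + teval e t
  | TScale c t => c *: teval e t
  | TOp ts => maop [ffun i => teval e (ts i)]
  end.

(* A variety is given by a set of identities t = 0; it is unitary when [u]
   is set. *)
Definition variety (k : fieldType) (m : nat) (u : bool) := set (term k m u).

Definition in_variety (k : fieldType) (m : nat) (u : bool)
    (M : variety k m u) (A : malg k m u) : Prop :=
  forall t, M t -> forall e : nat -> A, teval e t = 0.

Definition is_free (k : fieldType) (m : nat) (u : bool) (M : variety k m u)
    (X : Type) (A : malg k m u) (x : X -> A) : Prop :=
  in_variety M A /\
  forall B : malg k m u, in_variety M B -> forall g : X -> B,
    exists! f : A -> B, alg_hom f /\ (forall i, f (x i) = g i).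

(* [multihom x d a]: a is a linear combination of monomials in the x i that
   have degree d i in x i for every i. *)
Inductive multihom (k : fieldType) (m : nat) (u : bool) (X : eqType)
    (A : malg k m u) (x : X -> A) (d : X -> nat) : A -> Prop :=
| multihom_gen i : (forall j, d j = (j == i)) -> multihom x d (x i)
| multihom_one (h : u) : (forall j, d j = 0%N) -> multihom x d (maone A h)
| multihom_op (ds : 'I_m -> X -> nat) (v : {ffun 'I_m -> A}) :
    (forall i, multihom x (ds i) (v i)) ->
    (forall j, d j = (\sum_(i < m) ds i j)%N) -> multihom x d (maop v)
| multihom0 : multihom x d 0
| multihom_lin (c : k) (a b : A) :
    multihom x d a -> multihom x d b -> multihom x d (c *: a + b).

(* The algebra is the direct sum of its multihomogeneous components. *)
Definition graded_by_degrees (k : fieldType) (m : nat) (u : bool) (X : eqType)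
    (A : malg k m u) (x : X -> A) : Prop :=
  (forall a : A, exists (r : nat) (d : 'I_r -> X -> nat) (b : 'I_r -> A),
     (forall s, multihom x (d s) (b s)) /\ a = \sum_(s < r) b s) /\
  (forall (r : nat) (d : 'I_r -> X -> nat) (b : 'I_r -> A),
     (forall s t, d s =1 d t -> s = t) ->
     (forall s, multihom x (d s) (b s)) ->
     \sum_(s < r) b s = 0 -> forall s, b s = 0).

Section Derivations.
Variables (k : fieldType) (m : nat) (u : bool) (A : malg k m u).

Definition leibniz (D : A -> A) : Prop :=
  forall v : {ffun 'I_m -> A}, D (maop v) = \sum_(i < m) maop (upd v i (D (v i))).

Definition is_derivation : {pred A -> A} :=
  fun D => `[< linear D /\ leibniz D >].

Lemma is_derivation_submod : submod_closed is_derivation.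
Proof.
have op0 (v : {ffun 'I_m -> A}) i : maop (upd v i 0) = 0.
  have := maop_multilinear i v (-1) 0 0.
  by rewrite /= scaler0 addr0 scaleN1r addNr.
split.
  apply/asboolP; split=> [c a b|v]; first by rewrite /= scaler0 addr0.
  by rewrite big1 // => i _; rewrite op0.
move=> c D E /asboolP[linD leD] /asboolP[linE leE]; apply/asboolP; split.
  move=> a p q; change (c *: D (a *: p + q) + E (a *: p + q) =
    a *: (c *: D p + E p) + (c *: D q + E q)).
  rewrite linD linE !scalerDr !scalerA [c * a]mulrC -!addrA.
  by congr (_ + _); rewrite addrCA.
move=> v; change (c *: D (maop v) + E (maop v) =
  \sum_(i < m) maop (upd v i (c *: D (v i) + E (v i)))).
rewrite leD leE scaler_sumr -big_split /=; apply: eq_bigr => i _.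
by rewrite (maop_multilinear i v).
Qed.

HB.instance Definition _ :=
  GRing.isSubmodClosed.Build k (A -> A) is_derivation is_derivation_submod.

(* Der_k A, with its structure of subspace of the space of maps A -> A. *)
Record Der := MkDer { der_fun :> A -> A; _ : der_fun \in is_derivation }.

HB.instance Definition _ := [isSub for der_fun].
HB.instance Definition _ := [Choice of Der by <:].
HB.instance Definition _ := [SubChoice_isSubLmodule of Der by <:].

Definition locally_nilpotent (D : Der) : Prop :=
  forall a : A, exists p : nat, (1 <= p)%N /\ iter p D a = 0.

End Derivations.

Definition nontrivial_variety (k : fieldType) (m : nat) (u : bool)
    (M : variety k m u) : Prop :=
  exists B : malg k m u, in_variety M B /\ (exists b : B, b != 0).

Definition admissible (k : fieldType) (m : nat) (u : bool)
    (M : variety k m u) : Prop :=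
  [/\ nontrivial_variety M,
      forall (X : eqType) (A : malg k m u) (x : X -> A),
        is_free M x -> graded_by_degrees x
    & forall (X : eqType) (A : malg k m u) (x : X -> A),
        is_free M x -> forall F : X -> A,
        exists! D : Der A, forall i, D (x i) = F i].

Section Witt.
Variables (k : fieldType) (m : nat) (u : bool) (n : nat).
Variables (A : malg k m u) (x : 'I_n -> A).

(* D_F; the default value 0 is never used when x freely generates an algebra
   of an admissible variety. *)
Definition derF (F : 'I_n -> A) : Der A :=
  xget (0 : Der A) [set D : Der A | forall i, D (x i) = F i].

(* The derivation a∂_i. *)
Definition partial (a : A) (i : 'I_n) : Der A :=
  derF (fun j => if j == i then a else 0).

(* The product of the algebra L(A): since D = \sum_i (D x_i)∂_i and
   E = \sum_j (E x_j)∂_j, this is the bilinear extension of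
   (a∂_i) · (b∂_j) = ((a∂_i) b)∂_j; see lsw_mul_linearl, lsw_mul_linearr and
   lsw_mul_partial below. *)
Definition lsw_mul (D E : Der A) : Der A :=
  \sum_(i < n) \sum_(j < n) partial (partial (D (x i)) i (E (x j))) j.

End Witt.

Section WittTheory.
Variables (k : fieldType) (m : nat) (u : bool) (n : nat).
Variables (A : malg k m u) (x : 'I_n -> A).
Hypothesis ext : forall F : 'I_n -> A, exists! D : Der A, forall i, D (x i) = F i.

Lemma derFE F i : derF x F (x i) = F i.
Proof.
by have [D [DF _]] := ext F; rewrite /derF; exact: (@xgetI _ 0 [set E : Der A | forall j, E (x j) = F j] D DF) i.
Qed.

Lemma der_eq (D E : Der A) : (forall i, D (x i) = E (x i)) -> D = E.
Proof.
move=> DE; have [G [_ uG]] := ext (fun i => E (x i)).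
by rewrite -(uG D) // -(uG E).
Qed.

Lemma der_linear (D : Der A) : linear D.
Proof. by case: D => f /= /asboolP[]. Qed.

Lemma der_lincombE (c : k) (D E : Der A) a : (c *: D + E) a = c *: D a + E a.
Proof. by []. Qed.

Lemma der_sumE I (r : seq I) (D : I -> Der A) a :
  (\sum_(i <- r) D i) a = \sum_(i <- r) D i a.
Proof.
elim: r => [|i r IHr]; rewrite ?big_nil // !big_cons -IHr.
by rewrite -[D i in LHS]scale1r der_lincombE scale1r.
Qed.

Lemma partialE a i j : partial x a i (x j) = if j == i then a else 0.
Proof. exact: derFE. Qed.

Lemma der_expansion (D : Der A) : D = \sum_(i < n) partial x (D (x i)) i.
Proof.
apply: der_eq => l; rewrite der_sumE (bigD1 l) //= partialE eqxx big1 ?addr0 //.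
by move=> i /negPf il; rewrite partialE eq_sym il.
Qed.

Lemma lsw_mulE (D E : Der A) l : lsw_mul x D E (x l) = D (E (x l)).
Proof.
rewrite {2}(der_expansion D) /lsw_mul !der_sumE; apply: eq_bigr => i _.
rewrite der_sumE (bigD1 l) //= partialE eqxx big1 ?addr0 // => j /negPf jl.
by rewrite partialE eq_sym jl.
Qed.

Lemma lsw_mul_linearl E : linear (fun D => lsw_mul x D E).
Proof.
by move=> c D D'; apply: der_eq => l; rewrite der_lincombE !lsw_mulE.
Qed.

Lemma lsw_mul_linearr D : linear (lsw_mul x D).
Proof.
move=> c E E'; apply: der_eq => l.
by rewrite der_lincombE !lsw_mulE der_lincombE der_linear.
Qed.

Lemma lsw_mul_partial a b i j :
  lsw_mul x (partial x a i) (partial x b j) = partial x (partial x a i b) j.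
Proof.
apply: der_eq => l; rewrite lsw_mulE !partialE; case: eqP => // _.
have := der_linear (partial x a i) (-1) 0 0.
by rewrite scaler0 addr0 scaleN1r addNr.
Qed.

End WittTheory.

(* The left power a^r for r >= 1: a^1 = a and a^(r+1) = a (a^r). *)
Definition left_power (T : Type) (mul : T -> T -> T) (a : T) (r : nat) : T :=
  iter r.-1 (mul a) a.

Definition left_nilpotent (k : fieldType) (G : lmodType k) (mul : G -> G -> G)
    (a : G) : Prop :=
  exists r : nat, (2 <= r)%N /\ left_power mul a r = 0.

(* Main.v *)
(** An identity [D^r = 0] in [L(A)] says that the map [D^r] kills every
    generator, since the product of [L(A)] satisfies [(D E)(x_l) = D (E x_l)].
    By the Leibniz rule the elements killed by some power of [D] form a
    subalgebra, so local nilpotency can be tested on the finitely many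
    generators. *)
Require Import Defs.
From mathcomp Require Import all_boot all_algebra.

Set Implicit Arguments.
Unset Strict Implicit.
Unset Printing Implicit Defensive.

Import GRing.Theory.
Local Open Scope ring_scope.

Section NilpotencyDomain.
Variables (k : fieldType) (m : nat) (u : bool) (A : malg k m u).
Implicit Types (D : Der A) (v : {ffun 'I_m -> A}).

Lemma linear_map0 (V W : lmodType k) (f : V -> W) : linear f -> f 0 = 0.
Proof.
by move=> linf; have := linf (-1) 0 0; rewrite scaler0 addr0 scaleN1r addNr.
Qed.

Lemma maop_eq0 v i : v i = 0 -> maop v = 0.
Proof.
move=> vi0; have -> : v = upd v i 0.
  by apply/ffunP=> j; rewrite ffunE; case: eqP => // ->.
exact: linear_map0 (maop_multilinear i v).
Qed.

Lemma iter_der_linear D p : linear (iter p D).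
Proof.
by move=> c a b; elim: p => //= p ->; rewrite der_linear.
Qed.

Lemma iter_der_eq0_leq D p q a :
  (p <= q)%N -> iter p D a = 0 -> iter q D a = 0.
Proof.
move=> /subnK <- Da; rewrite iterD Da.
exact: linear_map0 (iter_der_linear D _).
Qed.

Lemma der_leibniz D : leibniz D.
Proof. by case: D => f /= /boolp.asboolP[]. Qed.

(** Writing the identity as the product of two identities, the Leibniz rule gives [D e = D e + D e];
    cancelling one summand works in every characteristic. *)
Lemma der_one D (h : u) : m = 2%N -> D (maone A h) = 0.
Proof.
move=> m2; set e := maone A h.
have i0 : 'I_m by rewrite m2; exact: ord0.
have De : D e = D e *+ 2.
  have -> : D e *+ 2 = \sum_(i < m) D e.
    by rewrite sumr_const card_ord; congr (_ *+ _).
  rewrite -{1}(maone_id h i0 e) der_leibniz; apply: eq_bigr => i _.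
  rewrite -[RHS](maone_id h i); congr (maop _).
  by apply/ffunP=> j; rewrite !ffunE -/e !if_same.
by apply: (addrI (D e)); rewrite addr0 -mulr2n -De.
Qed.

(** Peeling off one [D] at a time by induction on [N] replaces the multinomial Leibniz formula, so
    no coefficients appear. *)
Lemma iter_der_maop D N v (p : 'I_m -> nat) :
  (0 < m)%N -> (\sum_i p i <= N)%N -> (forall i, iter (p i) D (v i) = 0) ->
  iter N D (maop v) = 0.
Proof.
move=> m_gt0; elim: N v p => [|N IHN] v p.
  (* Here every exponent is 0, so every argument vanishes; [0 < m] provides one. *)
  rewrite leqn0 sum_nat_eq0 => /forallP p0 Dv; pose i := Ordinal m_gt0.
  by apply: (@maop_eq0 _ i); have := Dv i; rewrite (eqP (p0 i)).
move=> le_p Dv; rewrite iterSr der_leibniz.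
have -> : iter N D (\sum_i maop (upd v i (D (v i)))) =
          \sum_i iter N D (maop (upd v i (D (v i)))).
  apply: (big_morph (iter N D)) => [a b|].
    by have := iter_der_linear D N 1 a b; rewrite !scale1r.
  exact: linear_map0 (iter_der_linear D N).
(* An exponent 0 cannot be lowered, but then [v i], hence [D (v i)], is already 0. *)
apply: big1 => i _; case: (posnP (p i)) => [pi0 | pi_gt0].
  have vi0 : v i = 0 by have := Dv i; rewrite pi0.
  rewrite (@maop_eq0 _ i) ?ffunE ?eqxx ?vi0 ?(linear_map0 (der_linear D)) //.
  exact: linear_map0 (iter_der_linear D N).
(* Differentiating slot [i] lowers its exponent by one, so the new exponents sum to at most [N]. *)
apply: (IHN _ (fun j => if j == i then (p i).-1 else p j)).
  rewrite -ltnS; apply: leq_trans le_p.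
  rewrite (bigD1 i) //= eqxx [X in (_ < X)%N](bigD1 i) //=.
  rewrite -addSn prednK // leq_add2l.
  by apply: leq_sum => j /negPf ->.
by move=> j; rewrite ffunE; case: eqP => // _; rewrite -iterSr prednK.
Qed.

Lemma iter_der_multihom (X : eqType) (x : X -> A) D :
    (0 < m)%N -> (u -> m = 2%N) ->
    (forall i, exists p, iter p D (x i) = 0) ->
  forall d a, multihom x d a -> exists p, iter p D a = 0.
Proof.
move=> m_gt0 m2 Dx d a; elim=> {d a}.
- by move=> d i _.
- by move=> d h _; exists 1%N; apply: der_one (m2 h).
- move=> d ds v _ /fin_all_exists[p Dv] _.
  by exists (\sum_i p i)%N; apply: iter_der_maop Dv.
- by exists 0%N.
- move=> d c a b _ [p Da] _ [q Db]; exists (maxn p q).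
  rewrite iter_der_linear (iter_der_eq0_leq (leq_maxl p q) Da).
  by rewrite (iter_der_eq0_leq (leq_maxr p q) Db) scaler0 addr0.
Qed.

Lemma locally_nilpotent_generators (X : eqType) (x : X -> A) D :
    (0 < m)%N -> (u -> m = 2%N) -> graded_by_degrees x ->
    (forall i, exists p, iter p D (x i) = 0) ->
  locally_nilpotent D.
Proof.
move=> m_gt0 m2 [gen _] Dx a; have [r [d [b [hb ->]]]] := gen a.
have /fin_all_exists[p Db] s := iter_der_multihom m_gt0 m2 Dx (hb s).
(* The maximum may be 0; the successor ensures a positive exponent. *)
set q := \max_s p s; exists q.+1; split=> //.
elim/big_ind: (\sum_s b s) => [|y z Dy Dz|s _].
- exact: linear_map0 (iter_der_linear D _).
- by rewrite -[y]scale1r iter_der_linear Dy Dz scaler0 addr0.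
- exact: iter_der_eq0_leq (leqW (leq_bigmax s)) (Db s).
Qed.

(** Each left multiplication by [D] applies [D] once more to the value at [x l]. The index is a
    successor because [left_power] at 0 is [D], not the identity map. *)
Lemma left_powerE n (x : 'I_n -> A) D r l :
    (forall F : 'I_n -> A, exists! E : Der A, forall i, E (x i) = F i) ->
  left_power (lsw_mul x) D r.+1 (x l) = iter r.+1 D (x l).
Proof.
by move=> ext; rewrite /left_power; elim: r => //= r IHr; rewrite lsw_mulE // IHr.
Qed.

End NilpotencyDomain.

Theorem lemma2 (k : fieldType) (m : nat) (hm : (2 <= m)%N)
    (u : bool) (hu : u -> m = 2%N)
    (M : variety k m u) (hM : admissible M)
    (n : nat) (A : malg k m u) (x : 'I_n -> A) (hA : is_free M x)
    (D : Der A) :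
  locally_nilpotent D <-> left_nilpotent (lsw_mul x) D.
Proof.
have [_ graded ext_der] := hM.
have ext := ext_der _ _ _ hA.
split=> [nilD | [[|r] [// r_ge2 Dr0]]].
  have /fin_all_exists[p Dx] l : exists p, iter p D (x l) = 0.
    by have [p [_ Dp]] := nilD (x l); exists p.
  (* One exponent serves all of the finitely many generators; [.+2] meets the bound [2 <= r]. *)
  exists (\max_l p l).+2; split=> //.
  apply: (der_eq ext) => l; rewrite left_powerE //.
  exact: iter_der_eq0_leq (leqW (leqW (leq_bigmax l))) (Dx l).
apply: (locally_nilpotent_generators (ltnW hm) hu (graded _ _ _ hA)) => l.
by exists r.+1; rewrite -(left_powerE D r l ext) Dr0.
Qed.
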